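(* Let $\eta:\mathbb{R}^n\times\mathbb{R}^n\to\mathbb{R}^n$ and $w:\mathbb{R}^n\to\mathbb{R}^n$ be maps, let $g_1,\dots,g_m:\mathbb{R}^n\to\mathbb{R}$ be $w$-preinvex functions on $\mathbb{R}^n$ with respect to $\eta$ and $w$, and let $X=\{z\in\mathbb{R}^n : g_i(z)\le 0,\ i=1,\dots,m\}$ be a non-empty $w$-invex set with respect to $\eta$ and $w$. Let $h:\mathbb{R}^n\to\mathbb{R}$ be $w$-strictly preinvex on $X$ with respect to $\eta$ and $w$. Then the global optimal solution of the problem of minimizing $h(z)$ subject to $z\in X$ is unique, i.e. if $z_1,z_2\in X$ are both global minimizers of $h$ over $X$, then $z_1=z_2$.
   Context: Let $\eta:\mathbb{R}^n\times\mathbb{R}^n\to\mathbb{R}^n$ and $w:\mathbb{R}^n\to\mathbb{R}^n$. A non-empty set $X\subseteq\mathbb{R}^n$ is $w$-invex (with respect to $\eta$ and $w$) if $w(z_2)+\delta\,\eta(z_1,w(z_2))\in X$ for all $z_1,z_2\in X$ and $\delta\in[0,1]$. Given a $w$-invex set $X$, a function $h$ is: $w$-preinvex on $X$ if $h(w(z_2)+\delta\,\eta(z_1,w(z_2)))\le \delta h(z_1)+(1-\delta)h(z_2)$ for all $z_1,z_2\in X$ and $\delta\in[0,1]$; $w$-strictly preinvex on $X$ if $h(w(z_2)+\delta\,\eta(z_1,w(z_2)))< \delta h(z_1)+(1-\delta)h(z_2)$ for all $z_1,z_2\in X$ with $z_1\ne z_2$ and all $\delta\in(0,1)$. *)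

(* Defs.v *)
From mathcomp Require Import all_boot all_order all_algebra.
From mathcomp Require Import classical_sets reals.

Set Implicit Arguments.
Unset Strict Implicit.
Unset Printing Implicit Defensive.

Import Order.TTheory GRing.Theory Num.Theory.

Local Open Scope classical_set_scope.
Local Open Scope ring_scope.

Definition w_invex (R : realType) (n : nat)
    (eta : 'rV[R]_n -> 'rV[R]_n -> 'rV[R]_n) (w : 'rV[R]_n -> 'rV[R]_n)
    (X : set 'rV[R]_n) : Prop :=
  X !=set0 /\
  forall z1 z2 : 'rV[R]_n, X z1 -> X z2 ->
  forall delta : R, 0 <= delta <= 1 ->
    X (w z2 + delta *: eta z1 (w z2)).

(* As in the literature, the two notions below are only meant for a [w_invex]
   set [X]; that requirement is stated separately. *)
Definition w_preinvex (R : realType) (n : nat)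
    (eta : 'rV[R]_n -> 'rV[R]_n -> 'rV[R]_n) (w : 'rV[R]_n -> 'rV[R]_n)
    (X : set 'rV[R]_n) (h : 'rV[R]_n -> R) : Prop :=
  forall z1 z2 : 'rV[R]_n, X z1 -> X z2 ->
  forall delta : R, 0 <= delta <= 1 ->
    h (w z2 + delta *: eta z1 (w z2)) <= delta * h z1 + (1 - delta) * h z2.

Definition w_strictly_preinvex (R : realType) (n : nat)
    (eta : 'rV[R]_n -> 'rV[R]_n -> 'rV[R]_n) (w : 'rV[R]_n -> 'rV[R]_n)
    (X : set 'rV[R]_n) (h : 'rV[R]_n -> R) : Prop :=
  forall z1 z2 : 'rV[R]_n, X z1 -> X z2 -> z1 <> z2 ->
  forall delta : R, 0 < delta < 1 ->
    h (w z2 + delta *: eta z1 (w z2)) < delta * h z1 + (1 - delta) * h z2.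

Definition feasible_set (R : realType) (n m : nat)
    (g : 'I_m -> 'rV[R]_n -> R) : set 'rV[R]_n :=
  [set z | forall i : 'I_m, g i z <= 0].

Definition global_minimizer (R : realType) (n : nat)
    (X : set 'rV[R]_n) (h : 'rV[R]_n -> R) (z : 'rV[R]_n) : Prop :=
  X z /\ forall y : 'rV[R]_n, X y -> h z <= h y.

(* Main.v *)
Require Import Defs.
From mathcomp Require Import all_boot all_order all_algebra.
From mathcomp Require Import classical_sets reals.
From mathcomp Require Import ring lra.

Set Implicit Arguments.
Unset Strict Implicit.
Unset Printing Implicit Defensive.

Import Order.TTheory Num.Theory.

Local Open Scope classical_set_scope.
Local Open Scope ring_scope.

Lemma convex_combination_le_max (R : realDomainType) (x y t : R) :
  0 <= t <= 1 -> t * x + (1 - t) * y <= Num.max x y.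
Proof.
move=> /andP[t_ge0 t_le1].
have -> : Num.max x y = t * Num.max x y + (1 - t) * Num.max x y by ring.
by rewrite lerD// ler_wpM2l ?subr_ge0// le_max lexx ?orbT.
Qed.

Definition w_strictly_prequasiinvex (R : realType) (n : nat)
    (eta : 'rV[R]_n -> 'rV[R]_n -> 'rV[R]_n) (w : 'rV[R]_n -> 'rV[R]_n)
    (X : set 'rV[R]_n) (h : 'rV[R]_n -> R) : Prop :=
  forall z1 z2 : 'rV[R]_n, X z1 -> X z2 -> z1 <> z2 ->
  forall delta : R, 0 < delta < 1 ->
    h (w z2 + delta *: eta z1 (w z2)) < Num.max (h z1) (h z2).

Section StrictPreinvexity.
Variables (R : realType) (n : nat).
Variable eta : 'rV[R]_n -> 'rV[R]_n -> 'rV[R]_n.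
Variable w : 'rV[R]_n -> 'rV[R]_n.
Variables (X : set 'rV[R]_n) (h : 'rV[R]_n -> R).

Lemma w_strictly_preinvex_prequasiinvex :
  w_strictly_preinvex eta w X h -> w_strictly_prequasiinvex eta w X h.
Proof.
move=> h_preinvex z1 z2 Xz1 Xz2 z1_neq_z2 delta delta01.
apply: lt_le_trans (h_preinvex _ _ Xz1 Xz2 z1_neq_z2 _ delta01) _.
by apply: convex_combination_le_max; case/andP: delta01 => /ltW-> /ltW->.
Qed.

Lemma w_strictly_prequasiinvex_minimizer_unique (z1 z2 : 'rV[R]_n) :
  w_invex eta w X -> w_strictly_prequasiinvex eta w X h ->
  global_minimizer X h z1 -> global_minimizer X h z2 -> z1 = z2.
Proof.
move=> [_ X_invex] h_prequasiinvex [Xz1 z1_min] [Xz2 z2_min].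
apply/eqP/negPn/negP => /eqP z1_neq_z2.
pose mid := w z2 + 2^-1 *: eta z1 (w z2).
have X_mid : X mid by apply: X_invex => //; lra.
have mid_lt_max : h mid < Num.max (h z1) (h z2).
  by apply: h_prequasiinvex => //; lra.
have max_le_mid : Num.max (h z1) (h z2) <= h mid.
  by rewrite ge_max z1_min// z2_min.
by have := lt_le_trans mid_lt_max max_le_mid; rewrite ltxx.
Qed.

End StrictPreinvexity.

Theorem theorem4p1 (R : realType) (n m : nat)
    (eta : 'rV[R]_n -> 'rV[R]_n -> 'rV[R]_n) (w : 'rV[R]_n -> 'rV[R]_n)
    (g : 'I_m -> 'rV[R]_n -> R) (h : 'rV[R]_n -> R)
    (hg : forall i : 'I_m, w_preinvex eta w [set: 'rV[R]_n] (g i))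
    (hX : w_invex eta w (feasible_set g))
    (hh : w_strictly_preinvex eta w (feasible_set g) h) :
  forall z1 z2 : 'rV[R]_n,
    global_minimizer (feasible_set g) h z1 ->
    global_minimizer (feasible_set g) h z2 ->
    z1 = z2.
Proof.
move=> z1 z2; apply: w_strictly_prequasiinvex_minimizer_unique hX _.
exact: w_strictly_preinvex_prequasiinvex hh.
Qed.
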